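(* Let $L\ge 5$ be an integer, and let $H=4C_L$ be the disjoint union of four cycles of length $L$. There exist an orientation $\vec H$ of $H$ (each cycle being oriented as a directed cycle) and a bijective labeling $h:V(\vec H)\to\{1,2,\dots,4L\}$ that has a repetitive, consecutive pattern, such that $\vec H$ with this labeling is an $s$-nodes ornament, where $s=L-1$ if $L$ is odd and $s=L-2$ if $L$ is even.
   Context: All graphs are finite and simple. An oriented graph is a digraph without loops in which $(u,v)$ being an edge implies $(v,u)$ is not an edge. An orientation of a cycle is always taken to be a directed cycle: every vertex has exactly one incoming and one outgoing edge (so each cycle has two possible orientations, and different copies may be oriented differently). **Weight.** For an oriented graph $\vec G$ with an injective integer labeling $f$ of its vertices, the weight of a vertex $x$ is $\mathrm{wt}_f(x)=\sum_{y:\,(y,x)\in E(\vec G)} f(y)-\sum_{y:\,(x,y)\in E(\vec G)} f(y)$. **DDMOG.** A difference distance magic (DDM) labeling of an oriented graph $\vec G$ on $n$ vertices is a bijection $f:V(\vec G)\to\{1,\dots,n\}$ such that $\mathrm{wt}_f(x)$ is the same constant for all vertices $x$ (this constant is necessarily $0$). An oriented graph having a DDM labeling is a difference distance magic oriented graph (DDMOG). Edgeless graphs are (trivial) DDMOGs. **Weighted sum.** Let $\vec G$ be an oriented graph with vertices $v_1,\dots,v_n$ labeled by $g(v_i)=i$ (for a DDMOG, $g$ is its DDM labeling), and let $\vec H$ be an oriented graph, vertex-disjoint from $\vec G$, with injective labeling $h:V(\vec H)\to\mathbb{Z}^+$ and $|\mathrm{wt}_h(u)|\in\{0,1,\dots,n\}$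 for all $u\in V(\vec H)$. The weighted sum $\vec G\oplus_{\mathrm{wt}_h}\vec H$ has vertex set $V(\vec G)\cup V(\vec H)$ and edge set consisting of $E(\vec G)\cup E(\vec H)$ together with, for each $1\le i\le n$, all edges $(u,v_i)$ with $u\in V(\vec H)$, $\mathrm{wt}_h(u)=i$, and all edges $(v_i,u)$ with $u\in V(\vec H)$, $\mathrm{wt}_h(u)=-i$. **$s$-nodes ornament.** Let $\vec H$ be an orientation of $4C_L$ and let $h:V(\vec H)\to\{1,\dots,4L\}$ be a bijection. (The weights $\mathrm{wt}_{N+h}$ of the shifted labelings $u\mapsto N+h(u)$ do not depend on $N$.) $\vec H$ with this labeling is an $s$-nodes ornament if (i) for every integer $N\ge\max_u|\mathrm{wt}_h(u)|$, $N\ge1$, and every DDMOG $\vec G$ on $N$ vertices with DDM labeling $g$, the weighted sum $\vec G\oplus_{\mathrm{wt}_{N+h}}\vec H$ is a DDMOG with a DDM labeling given by $g$ on $V(\vec G)$ and $N+h$ on $V(\vec H)$; and (ii) exactly $s$ vertices of $\vec G$ (called nodes) are joined to vertices of $\vec H$ in this weighted sum, each of them to at least two vertices of $\vec H$. The labels of the nodes are their values under $g$; equivalently they are the distinct nonzero values of $|\mathrm{wt}_h|$. **Repetitive, consecutive pattern.** Let the four cycles $H_1,\dots,H_4$ be copies of one cycle $C_L$ with vertices $v_1,\dots,v_L$, and let $v_i^{(j-1)}$ denote the copy of $v_i$ in $H_j$. The labeling $h$ has a repetitive, consecutive pattern if there is a permutation $l$ of $\{1,\dots,L\}$ with $h(v_i^{(j-1)})=l(i)+(j-1)L$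 for all $1\le j\le 4$, $1\le i\le L$ (when attached to a DDMOG with $N$ vertices, all labels are shifted by $N$). *)

(* Defs.v *)
From HB Require Import structures.
From mathcomp Require Import all_boot all_order all_algebra all_fingroup.
Set Implicit Arguments.
Unset Strict Implicit.
Unset Printing Implicit Defensive.
Import Order.TTheory GRing.Theory Num.Theory.
Local Open Scope ring_scope.

(* A digraph on the finite vertex type V is given by its edge relation e, where
   e x y means that there is an edge from x to y. *)
Definition oriented (V : finType) (e : rel V) : Prop :=
  (forall x, ~~ e x x) /\ (forall x y, e x y -> ~~ e y x).

Definition wt (V : finType) (e : rel V) (f : V -> int) (x : V) : int :=
  \sum_(y | e y x) f y - \sum_(y | e x y) f y.

Definition bij_1_to (V : Type) (n : nat) (f : V -> int) : Prop :=
  injective f /\ (forall k : int, (1 <= k <= n%:Z) <-> exists x, f x = k).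

Definition ddm_labeling (V : finType) (e : rel V) (f : V -> int) : Prop :=
  bij_1_to #|V| f /\ exists c : int, forall x, wt e f x = c.

(* The vertex of G called v_i is the x with g x = i.  The definition is total;
   it is meaningful when g is a bijection onto {1, ..., #|V|} and the weights
   of h are at most #|V| in absolute value. *)
Definition weighted_sum (V W : finType) (eG : rel V) (g : V -> int)
    (eH : rel W) (h : W -> int) : rel (V + W)%type :=
  fun a b =>
    match a, b with
    | inl x, inl y => eG x y
    | inr u, inr w => eH u w
    | inr u, inl x => wt eH h u == g x
    | inl x, inr u => wt eH h u == - g x
    end.

Definition sum_labeling (V W : Type) (g : V -> int) (h : W -> int)
    (a : V + W) : int :=
  match a with inl x => g x | inr u => h u end.

Definition shift_labeling (W : Type) (N : nat) (h : W -> int) (u : W) : int :=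
  N%:Z + h u.

Definition cycle_adj (L : nat) : rel 'I_L :=
  fun a b => (b == ordS a) || (a == ordS b).

(* The vertex (j, i) of 4C_L is the copy of the i-th vertex of C_L in the j-th
   cycle; both indices start at 0. *)
Definition four_cycles_adj (L : nat) : rel ('I_4 * 'I_L)%type :=
  fun x y => (x.1 == y.1) && cycle_adj x.2 y.2.

Definition four_cycles_orientation (L : nat) (e : rel ('I_4 * 'I_L)%type) :
    Prop :=
  [/\ oriented e,
      forall x y, (e x y || e y x) = four_cycles_adj x y
    & forall x, #|[set y | e y x]| = 1%N /\ #|[set y | e x y]| = 1%N].

Definition joined (V W : finType) (e : rel (V + W)%type) (x : V) : {set W} :=
  [set u | e (inl x) (inr u) || e (inr u) (inl x)].

Definition ornament (L s : nat) (eH : rel ('I_4 * 'I_L)%type)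
    (h : 'I_4 * 'I_L -> int) : Prop :=
  [/\ four_cycles_orientation eH,
      bij_1_to (4 * L) h
    & forall (N : nat) (V : finType) (eG : rel V) (g : V -> int),
        (1 <= N)%N -> (forall u, `|wt eH h u| <= N%:Z) ->
        #|V| = N -> oriented eG -> ddm_labeling eG g ->
        let hN := shift_labeling N h in
        let eS := weighted_sum eG g eH hN in
        [/\ oriented eS,
            ddm_labeling eS (sum_labeling g hN),
            #|[set x | joined eS x != set0]| = s
          & forall x, joined eS x != set0 -> (2 <= #|joined eS x|)%N]].

(* l permutes {0, ..., L-1}, hence the successor; j also starts at 0, so it
   plays the role of j - 1 in h(v_i^(j-1)) = l(i) + (j-1)L. *)
Definition repetitive_consecutive (L : nat) (h : 'I_4 * 'I_L -> int) : Prop :=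
  exists l : {perm 'I_L},
    forall (j : 'I_4) (i : 'I_L), h (j, i) = ((l i).+1 + j * L)%N%:Z.

(* Main.v *)
(** Orient the four copies of C_L as +, -, -, + and label them by translates of
    one permutation l.  A vertex over v_i then has weight +-(l(i-1) - l(i+1)),
    and since 0 + 3 = 1 + 2 the labels entering any node always balance those
    leaving it, whatever l is.  Only the number of distinct values of
    |l(i-1) - l(i+1)| matters.  Placing the zigzag 0, L-1, 1, L-2, ... along the
    steps i -> i+2 gives consecutive differences L-1, L-2, ..., 1.  For L odd
    these steps form one cycle and the closing difference repeats an earlier
    one; for L even they form two cycles, which cuts the zigzag in the middle
    and loses exactly the difference L/2. *)
Require Import Defs.
From HB Require Import structures.
From mathcomp Require Import all_boot all_order all_algebra all_fingroup.
From mathcomp Require Import zify ring.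
Set Implicit Arguments.
Unset Strict Implicit.
Unset Printing Implicit Defensive.
Import Order.TTheory GRing.Theory Num.Theory.
Local Open Scope ring_scope.

(** * Weights and difference distance magic labelings *)

(** An edge from [y] to [x] adds [f y * f x] at its head and subtracts it at its tail. *)
Lemma sum_mul_wt (V : finType) (e : rel V) (f : V -> int) :
  \sum_x f x * wt e f x = 0.
Proof.
under eq_bigr do rewrite mulrBr !mulr_sumr.
rewrite sumrB (exchange_big_dep predT) //=; apply/eqP; rewrite subr_eq0.
by apply/eqP; apply: eq_bigr => x _; apply: eq_bigr => y _; rewrite mulrC.
Qed.

(** By [sum_mul_wt] the constant times the sum of all labels is 0, and the labels are positive. *)
Lemma ddm_constant_eq0 (V : finType) (e : rel V) (g : V -> int) :
  (0 < #|V|)%N -> ddm_labeling e g -> forall x, wt e g x = 0.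
Proof.
move=> /card_gt0P[x0 _] [[_ g_rng] [c cE]] x.
have g_gt0 y : 0 < g y by have /g_rng : exists z, g z = g y by [exists y]; lia.
have := sum_mul_wt e g; under eq_bigr do rewrite cE.
rewrite -mulr_suml cE => /eqP; rewrite mulf_eq0 => /orP[|/eqP//].
rewrite psumr_eq0 => [/allP/(_ x0)|y _]; last exact: ltW.
by rewrite mem_index_enum gt_eqF// => /(_ isT).
Qed.

(** Nodes will be counted through their labels, since [g] takes each value 1, ..., N once. The
    absolute value only turns a positive [int] into a [nat]. *)
Lemma count_ddm_labeling (V : finType) (N : nat) (g : V -> int) (S : pred nat) :
  bij_1_to N g -> #|[set x | S `|g x|%N]| = count S (iota 1 N).
Proof.
move=> [g_inj g_rng].
have g_gt0 y : 0 < g y <= N%:Z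
  by have /g_rng : exists z, g z = g y by [exists y]; lia.
rewrite cardsE cardE size_filter -(count_map (fun x => `|g x|%N) S).
move: S; apply/seq.permP; apply: uniq_perm; rewrite ?iota_uniq//.
  rewrite map_inj_uniq -?enumT ?enum_uniq// => x y xy; apply: g_inj.
  by have := g_gt0 x; have := g_gt0 y; lia.
move=> k; rewrite mem_iota; apply/mapP/idP => [[x _ ->]|k_in].
  by have := g_gt0 x; lia.
have /g_rng[x gx] : 1 <= k%:Z <= N%:Z by lia.
by exists x; rewrite ?gx// -enumT mem_enum.
Qed.

(** * Weighted sums *)

Section WeightedSum.
Variables (V W : finType) (eG : rel V) (g : V -> int) (eH : rel W).
Variable h : W -> int.
Let eS := weighted_sum eG g eH h.
Let f := sum_labeling g h.

Lemma wt_weighted_sum_inl x : wt eS f (inl x) = wt eG g x +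
  (\sum_(u | wt eH h u == g x) h u - \sum_(u | wt eH h u == - g x) h u).
Proof. by rewrite {1}/wt !big_sumType/= opprD addrACA. Qed.

Lemma wt_weighted_sum_inr u : wt eS f (inr u) = wt eH h u +
  (\sum_(x | wt eH h u == - g x) g x - \sum_(x | wt eH h u == g x) g x).
Proof. by rewrite {1}/wt !big_sumType/= opprD addrACA addrC. Qed.

(** If [u] has weight w <> 0 in H, it meets exactly one vertex of G, the one labeled |w|, and that
    edge contributes -w. If w = 0 it meets none, labels being positive. *)
Lemma weighted_sum_cancels u : bij_1_to #|V| g -> `|wt eH h u| <= #|V|%:Z ->
  wt eS f (inr u) = 0.
Proof.
move=> [g_inj g_rng] wN; rewrite wt_weighted_sum_inr.
move: (wt eH h u) wN => w wN.
have g_gt0 y : 0 < g y by have /g_rng : exists z, g z = g y by [exists y]; lia.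
have [w0|w0|->] := ltrgt0P w.
- have /g_rng[x gx] : 1 <= w <= #|V|%:Z by lia.
  rewrite big_pred0 => [|y]; last by have := g_gt0 y; lia.
  rewrite (big_pred1 x) => [|y]; first by rewrite gx; ring.
  by rewrite -gx (inj_eq g_inj) eq_sym.
- have /g_rng[x gx] : 1 <= - w <= #|V|%:Z by lia.
  rewrite [X in _ - X]big_pred0 => [|y]; last by have := g_gt0 y; lia.
  rewrite (big_pred1 x) => [|y]; first by rewrite gx; ring.
  by rewrite -eqr_oppLR -gx (inj_eq g_inj) eq_sym.
- by rewrite !big_pred0 => [//|y|y]; have := g_gt0 y; lia.
Qed.

Lemma oriented_weighted_sum : (forall x, 0 < g x) ->
  oriented eG -> oriented eH -> oriented eS.
Proof.
move=> g_gt0 [irrG asymG] [irrH asymH]; split=> [[x|u]|[x|u] [y|w]] //=.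
- exact: asymG.
- by have := g_gt0 x; lia.
- by have := g_gt0 y; lia.
- exact: asymH.
Qed.

End WeightedSum.

Lemma bij_sum_labeling (V W : Type) (M N : nat) (g : V -> int) (h : W -> int) :
  bij_1_to N g -> bij_1_to M h ->
  bij_1_to (N + M) (sum_labeling g (shift_labeling N h)).
Proof.
move=> [g_inj g_rng] [h_inj h_rng].
have gP y : 1 <= g y <= N%:Z by apply/g_rng; exists y.
have hP y : 1 <= h y <= M%:Z by apply/h_rng; exists y.
rewrite /shift_labeling; split=> [[x|u] [y|w]/= E|k].
- by rewrite (g_inj _ _ E).
- by have := gP x; have := hP w; lia.
- by have := gP y; have := hP u; lia.
- by congr inr; apply: h_inj; lia.
split=> [k_in|[[x|u]/= <-]]; last 2 first.
- by have := gP x; lia.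
- by have := hP u; lia.
have [kN|kN] := lerP k N%:Z.
  have /g_rng[x gx] : 1 <= k <= N%:Z by lia.
  by exists (inl x).
have /h_rng[u hu] : 1 <= k - N%:Z <= M%:Z by lia.
by exists (inr u); rewrite /= hu; ring.
Qed.

(** * Four oriented copies labeled by translates of one permutation *)

Section Repetitive.
Variables (L : nat) (hL : (2 < L)%N) (l : {perm 'I_L}).

Definition forward (j : 'I_4) : bool := (j == 0 :> nat) || (j == 3 :> nat).

Definition four_cycles : rel ('I_4 * 'I_L)%type := fun x y =>
  (x.1 == y.1) && if forward x.1 then y.2 == ordS x.2 else x.2 == ordS y.2.

Definition repeat_label (x : 'I_4 * 'I_L) : int :=
  ((l x.2).+1 + x.1 * L)%N%:Z.

(** The weight over [i] in a forward copy; a backward copy has its opposite. *)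
Definition gap (i : 'I_L) : int := (l (ord_pred i))%:Z - (l (ordS i))%:Z.

Lemma ordS_neq (i : 'I_L) : (i == ordS i) = false.
Proof.
apply/negbTE/eqP => /(congr1 val)/= ; have := ltn_ord i.
have [iL|iL] := ltnP i.+1 L; first by rewrite modn_small//; lia.
by move=> ?; have -> : i.+1 = L by [lia]; rewrite modnn; lia.
Qed.

Lemma ordS2E (i : 'I_L) : ordS (ordS i) = ((i + 2) %% L)%N :> nat.
Proof. by rewrite /= -addn1 modnDml addn1 addn2. Qed.

(** This excludes opposite edges: both directions between two vertices would force i = i + 2 modulo
    L. *)
Lemma ordS2_neq (i : 'I_L) : (i == ordS (ordS i)) = false.
Proof.
apply/negbTE/eqP => /(congr1 val); rewrite [RHS]ordS2E; have := ltn_ord i.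
have [iL|iL] := ltnP (i + 2) L; first by rewrite modn_small//=; lia.
move=> iL'; rewrite -(subnK iL) modnDr modn_small/=; lia.
Qed.

Lemma four_cyclesP : four_cycles_orientation four_cycles.
Proof.
have mem1 x : [set y | four_cycles y x] =
    [set (x.1, if forward x.1 then ord_pred x.2 else ordS x.2)].
  case: x => j i; apply/setP => -[j' i']; rewrite !inE /four_cycles/= xpair_eqE.
  case: (j' =P j) => //= ->; case: forward => //.
  by rewrite -(can2_eq (@ordSK L) (@ord_predK L)) eq_sym.
have mem2 x : [set y | four_cycles x y] =
    [set (x.1, if forward x.1 then ordS x.2 else ord_pred x.2)].
  case: x => j i; apply/setP => -[j' i']; rewrite !inE /four_cycles/= xpair_eqE.
  rewrite eq_sym; case: (j' =P j) => //= _; case: forward => //.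
  by rewrite -(can2_eq (@ordSK L) (@ord_predK L)) eq_sym.
split=> [|[j i] [j' i']|x]; last by rewrite mem1 mem2 !cards1.
- split=> [[j i]|[j i] [j' i']]; rewrite /four_cycles/= ?eqxx ?ordS_neq ?if_same//.
  case: eqP => //= <-; rewrite eqxx/=.
  by case: forward => /eqP ->; rewrite ordS2_neq.
- rewrite /four_cycles /four_cycles_adj /cycle_adj/= (eq_sym j' j).
  by case: (j =P j') => //= <-; case: forward; rewrite // orbC.
Qed.

Lemma wt_shift_repeat (N : nat) (x : 'I_4 * 'I_L) :
  wt four_cycles (shift_labeling N repeat_label) x =
  if forward x.1 then gap x.2 else - gap x.2.
Proof.
case: four_cyclesP => _ _ _; case: x => j i; rewrite /wt.
rewrite (big_pred1 (j, if forward j then ord_pred i else ordS i)); last first.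
  move=> [j' i']; rewrite /four_cycles/= xpair_eqE.
  case: (j' =P j) => //= ->; case: forward => //.
  by rewrite -(can2_eq (@ordSK L) (@ord_predK L)) eq_sym.
rewrite (big_pred1 (j, if forward j then ordS i else ord_pred i)); last first.
  move=> [j' i']; rewrite /four_cycles/= xpair_eqE.
  rewrite eq_sym; case: (j' =P j) => //= _; case: forward => //.
  by rewrite -(can2_eq (@ordSK L) (@ord_predK L)) eq_sym.
by rewrite /shift_labeling /repeat_label /gap/=; case: forward; lia.
Qed.

Lemma wt_repeat (x : 'I_4 * 'I_L) :
  wt four_cycles repeat_label x = if forward x.1 then gap x.2 else - gap x.2.
Proof.
by rewrite -(wt_shift_repeat 0); congr (_ - _); apply: eq_bigr => y _;
  rewrite /shift_labeling add0r.
Qed.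

Lemma bij_repeat : bij_1_to (4 * L) repeat_label.
Proof.
rewrite /repeat_label; split=> [[j i] [j' i'] [/=]|k].
  rewrite ![(_ + _ * L)%N]addnC => E.
  have lt_i := ltn_ord (l i); have lt_i' := ltn_ord (l i').
  have jj' : j = j'.
    by have [jj'|jj'|/val_inj//] := ltngtP j j'; have := leq_mul jj' (leqnn L); lia.
  by move: E; rewrite jj' => /addnI/val_inj/perm_inj ->.
split=> [k_in|[[j i] <-]/=]; last first.
  by have := ltn_ord (l i); have := leq_mul (ltn_ord j) (leqnn L); lia.
(* Dividing k - 1 by L gives the copy as quotient and the value of [l] as remainder. *)
have k_lt : (`|k|.-1 < 4 * L)%N by lia.
have j_lt : (`|k|.-1 %/ L < 4)%N by rewrite ltn_divLR; lia.
have i_lt : (`|k|.-1 %% L < L)%N by rewrite ltn_mod; lia.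
exists (Ordinal j_lt, (l^-1)%g (Ordinal i_lt)); rewrite permKV/=.
by have := divn_eq `|k|.-1 L; lia.
Qed.

(** Over each [i], copies 0 and 3 have weight [gap i], copies 1 and 2 have [- gap i], and both pairs
    have the same label sum. Replacing k by -k swaps the pairs. *)
Lemma repeat_balanced (N : nat) (k : int) :
  let hN := shift_labeling N repeat_label in
  \sum_(u | wt four_cycles hN u == k) hN u =
  \sum_(u | wt four_cycles hN u == - k) hN u.
Proof.
move=> hN; rewrite [LHS]big_mkcond [RHS]big_mkcond/=.
under eq_bigr do rewrite wt_shift_repeat.
under [RHS]eq_bigr do rewrite wt_shift_repeat.
pose F k (j : 'I_4) (i : 'I_L) := 
  if (if forward j then gap i else - gap i) == k then hN (j, i) else 0.
have pairE k' : \sum_u (if (if forward u.1 then gap u.2 else - gap u.2) == k'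
    then hN u else 0) = \sum_j \sum_i F k' j i.
  by rewrite pair_big; apply: eq_bigr => -[].
rewrite !pairE exchange_big [RHS]exchange_big; apply: eq_bigr => i _.
rewrite !big_ord_recl !big_ord0 /F /forward /hN /shift_labeling /repeat_label/=.
rewrite !eqr_opp -eqr_oppLR.
rewrite /bump/=; by case: (gap i == k); case: (- gap i == k); lia.
Qed.

(** Reduces the ornament property to counting gaps: [S] decides which values |gap| takes. Counting
    from 1 drops a possible weight 0, which yields no node. *)
Lemma ornament_repeat (S : pred nat) (s : nat) :
  (forall k, reflect (exists i, `|gap i|%N = k) (S k)) ->
  (forall N, (forall k, S k -> (k <= N)%N) -> count S (iota 1 N) = s) ->
  ornament s four_cycles repeat_label.
Proof.
move=> S_gap S_count; split; [exact: four_cyclesP|exact: bij_repeat|].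
move=> N V eG g N_gt0 wtN cardV orG ddmG hN eS.
have [bij_g _] := ddmG; rewrite cardV in bij_g.
have g_gt0 y : 0 < g y.
  by have /bij_g.2 : exists z, g z = g y by [exists y]; lia.
have wtE u : wt four_cycles hN u = if forward u.1 then gap u.2 else - gap u.2.
  exact: wt_shift_repeat.
(* The orientation of a copy changes only the sign of the weight, so the direction of the joining
   edge but not its presence. *)
have joinedE x : joined eS x = [set u | `|gap u.2|%N == `|g x|%N].
  apply/setP => u; rewrite !inE/= -/hN wtE; move: (g x) (g_gt0 x) (gap u.2) => c c_gt0 a.
  by case: forward; lia.
have joined_neq0 x : (joined eS x != set0) = S `|g x|%N.
  rewrite joinedE; apply/set0Pn/S_gap => [[[j i]]|[i gi]].
    by rewrite inE => /eqP; exists i.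
  by exists (ord0, i); rewrite inE/= gi.
split.
- by apply: oriented_weighted_sum => //; case: four_cyclesP.
- split.
    rewrite card_sum cardV card_prod !card_ord.
    by apply: bij_sum_labeling bij_repeat.
  exists 0 => -[x|u].
    rewrite wt_weighted_sum_inl (ddm_constant_eq0 _ ddmG) ?cardV//.
    by rewrite repeat_balanced subrr addr0.
  apply: weighted_sum_cancels; rewrite cardV//.
  by rewrite wtE -wt_repeat.
- under eq_finset do rewrite joined_neq0.
  rewrite (count_ddm_labeling _ bij_g); apply: S_count => k /S_gap[i <-].
  by have := wtN (ord0, i); rewrite wt_repeat/=; lia.
- move=> x; rewrite joined_neq0 joinedE => /S_gap[i gi].
  (* Copies 0 and 3 over the same [i] provide two neighbours. *)
  by apply/card_gt1P; exists (ord0, i), (ord_max, i); rewrite !inE gi !eqxx.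
Qed.

End Repetitive.

(** * The zigzag permutation and its gaps *)

Section Zigzag.
Variables (L : nat) (hL : (5 <= L)%N).

(* [step_rank i] is the position of [i] in the sequence 0, 2, 4, ... followed
   by 1, 3, 5, ...: steps of [+2] in Z/L run through it in order. *)
Definition step_rank (i : nat) : nat := if odd i then (i + L)./2 else i./2.

(** The classical graceful labeling of a path, with labels starting at 0. *)
Definition zigzag (t : nat) : nat := if odd t then (L - 1 - t./2)%N else t./2.

Lemma step_rank_lt (i : nat) : (i < L)%N -> (step_rank i < L)%N.
Proof. by rewrite /step_rank; case: ifPn; lia. Qed.

Lemma step_rank_inj : {in gtn L &, injective step_rank}.
Proof. by move=> i j; rewrite !inE/= /step_rank; do 2!case: ifPn; lia. Qed.

Lemma zigzag_lt (t : nat) : (t < L)%N -> (zigzag t < L)%N.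
Proof. by rewrite /zigzag; case: ifPn; lia. Qed.

Lemma zigzag_inj : {in gtn L &, injective zigzag}.
Proof. by move=> t u; rewrite !inE/= /zigzag; do 2!case: ifPn; lia. Qed.

Lemma zigzag_step (t : nat) : (t.+1 < L)%N ->
  `|(zigzag t)%:Z - (zigzag t.+1)%:Z|%N = (L - 1 - t)%N.
Proof. by rewrite /zigzag/=; case: ifPn => ? /=; lia. Qed.

Definition zigzag_ord (i : 'I_L) : 'I_L :=
  Ordinal (zigzag_lt (step_rank_lt (ltn_ord i))).

Lemma zigzag_ord_inj : injective zigzag_ord.
Proof.
move=> i j [] E; apply: val_inj; apply: step_rank_inj; rewrite ?inE//=.
by apply: zigzag_inj E; rewrite inE/= step_rank_lt.
Qed.

Definition zigzag_perm : {perm 'I_L} := perm zigzag_ord_inj.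

Definition zigzag_gaps (k : nat) : bool :=
  (0 < k < L)%N && (odd L || (k != L./2)).

Lemma mod_pred2 : ((L - 1 + 2) %% L = 1)%N.
Proof. by rewrite (_ : (L - 1 + 2 = 1 + L)%N) ?modnDr ?modn_small; lia. Qed.

(** The excluded indices are those where a step returns to the start of its cycle: [L - 2] to 0, and
    for even L also [L - 1] to 1. *)
Lemma step_rank_step (i : nat) : (i < L)%N -> (i != L - 2)%N ->
  odd L || (i != L - 1)%N ->
  step_rank ((i + 2) %% L) = (step_rank i).+1.
Proof.
move=> iL iL2 iL1; rewrite /step_rank; have [lt2|ge2] := ltnP (i + 2) L.
  by rewrite modn_small//; do 2!case: ifPn; lia.
have -> : i = (L - 1)%N by lia.
rewrite mod_pred2.
by rewrite /=; case: ifPn; lia.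
Qed.

Lemma gap_zigzag (i : 'I_L) : `|gap zigzag_perm (ordS i)|%N =
  `|(zigzag (step_rank i))%:Z - (zigzag (step_rank ((i + 2) %% L)))%:Z|%N.
Proof. by rewrite /gap ordSK !permE -ordS2E. Qed.

Lemma zigzag_gapsP (k : nat) :
  reflect (exists i, `|gap zigzag_perm i|%N = k) (zigzag_gaps k).
Proof.
apply: (iffP idP) => [|[i <-]].
  rewrite /zigzag_gaps => k_in; pose t := (L - 1 - k)%N.
  (* The vertex of rank [t], by inverting [step_rank]; the zigzag difference after rank [t] is k. *)
  pose a := (if 2 * t < L then 2 * t else 2 * t - L + ~~ odd L)%N.
  have [a_lt a_neq a_neq' at_] : [/\ a < L, a != L - 2, odd L || (a != L - 1) &
      step_rank a = t]%N.
    by rewrite /step_rank /a /t; case: ifPn => ?; split; try case: ifPn; lia.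
  exists (ordS (Ordinal a_lt)).
  by rewrite gap_zigzag step_rank_step//= at_ zigzag_step /t; lia.
rewrite -(ord_predK i) gap_zigzag; move: (ord_pred i) => {i} [i i_lt] /=.
(* Closing step to 0: the gap is (L-1)/2 for odd L, and (L-2)/4 or 3L/4 for even L, all allowed
   values. *)
have [->|i_neq] := eqVneq i (L - 2)%N.
  rewrite subnK ?modnn; last by lia.
  rewrite /zigzag_gaps subr0 absz_nat /zigzag /step_rank.
  by case: (ifPn (odd (L - 2))) => ?; case: ifPn => ?; lia.
(* For even L, the closing step to 1 has gap L/4 or (L-2)/4. *)
have [/andP[Leven /eqP->]|] := boolP (~~ odd L && (i == L - 1)%N).
  have -> : step_rank (L - 1) = (L - 1)%N by rewrite /step_rank; case: ifPn; lia.
  have -> : step_rank ((L - 1 + 2) %% L) = L./2.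
    by rewrite mod_pred2 /step_rank/=; lia.
  rewrite /zigzag_gaps /zigzag.
  by case: ifPn => ?; case: ifPn => ?; lia.
rewrite negb_and negbK => i_neq'.
have := step_rank_lt i_lt; rewrite step_rank_step// => t_lt.
(* For even L, gap L/2 would need a successor of rank L/2, which is vertex 1, reached only by the
   closing step. *)
have : ((step_rank i).+1 < L)%N /\ (odd L || ((step_rank i).+1 != L./2)).
  by rewrite /step_rank; case: ifPn; lia.
rewrite /zigzag_gaps; case=> t_lt' t_neq.
by rewrite zigzag_step//; lia.
Qed.

Lemma count_zigzag_gaps N : (forall k, zigzag_gaps k -> (k <= N)%N) ->
  count zigzag_gaps (iota 1 N) = if odd L then (L - 1)%N else (L - 2)%N.
Proof.
move=> le_N; have LN : (L - 1 <= N)%N by apply: le_N; rewrite /zigzag_gaps; lia.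
rewrite -(subnKC LN) iotaD count_cat.
rewrite [X in (_ + X)%N](@eq_in_count _ _ pred0) => [|k]; last first.
  by rewrite mem_iota /zigzag_gaps/=; lia.
rewrite count_pred0 addn0.
rewrite (@eq_in_count _ _ (fun k => odd L || (k != L./2))) => [|k]; last first.
  by rewrite mem_iota /zigzag_gaps; lia.
case: ifP => oddL /=; first by rewrite count_predT size_iota.
(* For even L, exactly one of 1, ..., L-1 is lost. *)
have := count_predC (pred1 L./2) (iota 1 (L - 1)).
rewrite count_uniq_mem ?iota_uniq// mem_iota size_iota.
by set c := count _ _; lia.
Qed.

End Zigzag.

Theorem theorem2p3 (L : nat) (hL : (5 <= L)%N) :
  exists (e : rel ('I_4 * 'I_L)%type) (h : 'I_4 * 'I_L -> int),
    [/\ four_cycles_orientation e,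
        bij_1_to (4 * L) h,
        repetitive_consecutive h
      & ornament (if odd L then (L - 1)%N else (L - 2)%N) e h].
Proof.
have L_gt2 : (2 < L)%N by lia.
exists (@four_cycles L), (repeat_label (zigzag_perm hL)); split.
- exact: four_cyclesP.
- exact: bij_repeat.
- by exists (zigzag_perm hL).
- apply: ornament_repeat (@zigzag_gapsP L hL) _ => //.
  exact: count_zigzag_gaps.
Qed.
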